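(* Let $R$ be a finite chain ring and let $A\in R^{m\times n}$ be a matrix of McCoy's rank $r$. Then there exists a unique $m\times n$ $r$-sub-permutation matrix $\mathcal{R}_A$ such that every leading sub-matrix of $\mathcal{R}_A$ has the same McCoy's rank as the corresponding leading sub-matrix of $A$.
   Context: A finite chain ring is a finite commutative ring with identity whose ideals are totally ordered by inclusion (equivalently, a finite local ring whose maximal ideal is principal). For a matrix $A$ over a commutative ring $R$ with unity, $I_t(A)$ denotes the ideal of $R$ generated by all $t\times t$ minors of $A$, with $I_0(A)=R$ (and $I_t(A)=(0)$ for $t>\min(m,n)$). For $S\subseteq R$, $\mathrm{Ann}(S)=\{x\in R: xy=0\ \forall y\in S\}$. McCoy's rank of $A$ is $\max\{t:\mathrm{Ann}(I_t(A))=(0)\}$. An $r$-sub-permutation matrix is a matrix of rank $r$ with only $r$ nonzero entries, all equal to one (hence at most one nonzero entry per row and per column). A leading sub-matrix of an $m\times n$ matrix is the sub-matrix formed by its first $i$ rows and first $j$ columns, for some $1\le i\le m$, $1\le j\le n$. *)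

(* Defs.v *)
From mathcomp Require Import all_boot all_order all_algebra.

Set Implicit Arguments.
Unset Strict Implicit.
Unset Printing Implicit Defensive.

Import GRing.Theory.

Local Open Scope ring_scope.

(* The whole ring is allowed, unlike in MathComp's [idealr_closed], whose
   ideals are proper. *)
Definition is_ideal (R : finComNzRingType) (I : {set R}) : bool :=
  [&& 0 \in I,
      [forall x in I, forall y in I, x + y \in I]
    & [forall a : R, forall x in I, a * x \in I]].

Definition gen_ideal (R : finComNzRingType) (S : {set R}) : {set R} :=
  \bigcap_(I : {set R} | is_ideal I && (S \subset I)) I.

Definition Ann (R : finComNzRingType) (S : {set R}) : {set R} :=
  [set x | [forall y in S, x * y == 0]].

(* Finiteness, commutativity and 1 != 0 come from the structure on R. *)
Definition chain_ring (R : finComNzRingType) : Prop :=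
  forall I J : {set R}, is_ideal I -> is_ideal J ->
    (I \subset J) || (J \subset I).

Definition strictly_increasing (t m : nat) (f : {ffun 'I_t -> 'I_m}) : bool :=
  [forall a : 'I_t, forall b : 'I_t, (a < b)%N ==> (f a < f b)%N].

(* Rows and columns are selected by strictly increasing maps, so there is no
   minor when t > minn m n, and the only minor for t = 0 is the empty
   determinant 1. *)
Definition minors (R : finComNzRingType) (m n t : nat) (A : 'M[R]_(m, n)) :
    {set R} :=
  [set \det (mxsub f g A) | f : {ffun 'I_t -> 'I_m} in @strictly_increasing t m,
                            g : {ffun 'I_t -> 'I_n} in @strictly_increasing t n].

Definition minor_ideal (R : finComNzRingType) (m n t : nat)
    (A : 'M[R]_(m, n)) : {set R} :=
  gen_ideal (minors t A).

(* The range of t loses nothing: for t > minn m n the minor ideal is (0),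
   whose annihilator is R, not (0); t = 0 always qualifies. *)
Definition mccoy_rank (R : finComNzRingType) (m n : nat) (A : 'M[R]_(m, n)) :
    nat :=
  \max_(t < (minn m n).+1 | Ann (minor_ideal t A) == [set 0]) t.

Definition sub_permutation (R : finComNzRingType) (m n r : nat)
    (P : 'M[R]_(m, n)) : Prop :=
  [/\ mccoy_rank P = r,
      #|[set ij : 'I_m * 'I_n | P ij.1 ij.2 != 0]| = r
    & forall i j, P i j != 0 -> P i j = 1].

Definition leading (R : finComNzRingType) (m n i j : nat)
    (le_im : (i <= m)%N) (le_jn : (j <= n)%N) (A : 'M[R]_(m, n)) :
    'M[R]_(i, j) :=
  mxsub (widen_ord le_im) (widen_ord le_jn) A.

(* Main.v *)
From HB Require Import structures.
From mathcomp Require Import all_boot all_order all_algebra zify.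
From mathcomp Require Import ring_quotient.
Require Import Defs.

(* A chain ring is local, and its nonunits are annihilated by a common nonzero
   element, so Ann (I_t(A)) = (0) means that some t x t minor of A is a unit:
   McCoy's rank of A is the rank of the image of A over the residue field K.
   Over K, let r(i, j) be the rank of the leading i x j window. Frobenius'
   inequality gives r(k, j) + r(i, l) <= r(i, j) + r(k, l) for k <= i, l <= j,
   and r grows by at most 1 with each row or column; hence the second
   difference of r is the indicator of a partial permutation S, and r(i, j)
   counts the elements of S in the window. Conversely, since the rank is
   subadditive and bounded by the number of nonzero entries, a matrix of rank r
   with r nonzero entries must have, in each leading window, rank equal to the
   number of nonzero entries there, and these counts determine the support. *)

Set Implicit Arguments.
Unset Strict Implicit.
Unset Printing Implicit Defensive.

Import GRing.Theory.
Local Open Scope ring_scope.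

(** * Units, annihilators and the residue field of a finite chain ring *)

Definition invertible (R : finComNzRingType) (x : R) : bool :=
  [exists y, x * y == 1].

Section Ideals.
Variable R : finComNzRingType.
Implicit Types (x y z : R) (I S : {set R}).

Lemma idealP I :
  reflect [/\ 0 \in I, {in I &, forall x y, x + y \in I}
            & forall a, {in I, forall x, a * x \in I}]
          (is_ideal I).
Proof.
apply: (iffP and3P) => -[I0 ID IM]; split=> //.
- by move=> x y Ix Iy; move/forall_inP/(_ x Ix)/forall_inP/(_ y Iy): ID.
- by move=> a x Ix; move/forallP/(_ a)/forall_inP/(_ x Ix): IM.
- by apply/forall_inP=> x Ix; apply/forall_inP=> y; apply: ID.
- by apply/forallP=> a; apply/forall_inP=> x; apply: IM.
Qed.

Lemma mem_gen_ideal S x : x \in S -> x \in gen_ideal S.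
Proof. by move=> Sx; apply/bigcapP=> I /andP[_ /subsetP]; apply. Qed.

Lemma gen_ideal_sub S I : is_ideal I -> S \subset I -> gen_ideal S \subset I.
Proof. by move=> idI sSI; apply: bigcap_inf; rewrite idI. Qed.

Definition principal x : {set R} := [set x * y | y : R].

Lemma principal_id x : x \in principal x.
Proof. by apply/imsetP; exists 1; rewrite ?mulr1. Qed.

Lemma principal_ideal x : is_ideal (principal x).
Proof.
apply/idealP.
split=> [|_ _ /imsetP[a _ ->] /imsetP[b _ ->]|a _ /imsetP[b _ ->]].
- by apply/imsetP; exists 0; rewrite ?mulr0.
- by rewrite -mulrDr imset_f.
- by rewrite mulrCA imset_f.
Qed.

Lemma invertible1 : invertible (1 : R).
Proof. by apply/existsP; exists 1; rewrite mulr1. Qed.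

Lemma invertibleM x y : invertible (x * y) = invertible x && invertible y.
Proof.
apply/existsP/andP=> [[z /eqP xyz]|[/existsP[a /eqP xa] /existsP[b /eqP yb]]].
  split; apply/existsP; first by exists (y * z); rewrite mulrA xyz.
  by exists (x * z); rewrite mulrCA mulrA xyz.
by exists (a * b); rewrite mulrACA xa yb mulr1.
Qed.

Lemma invertible0 : invertible (0 : R) = false.
Proof. by apply/existsP=> -[y]; rewrite mul0r eq_sym oner_eq0. Qed.

Hypothesis chainR : chain_ring R.

(** One of [x], [y] divides the other by the chain condition, so the divisor also divides the sum
    and is a unit as soon as the sum is one. *)
Lemma invertibleD x y : invertible (x + y) -> invertible x || invertible y.
Proof.
have aux u v : principal u \subset principal v -> invertible (u + v) ->
    invertible v.
  move/subsetP/(_ _ (principal_id u)) => /imsetP[a _ ->].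
  by rewrite -[X in _ + X]mulr1 -mulrDr invertibleM => /andP[].
have [/aux|/aux] := orP (chainR (principal_ideal x) (principal_ideal y)).
  by move=> /[apply] ->; rewrite orbT.
by rewrite addrC => /[apply] ->.
Qed.

Lemma nonunits_ideal : is_ideal [set x : R | ~~ invertible x].
Proof.
apply/idealP; split=> [|x y|a x]; rewrite !inE ?invertible0 // => nx.
  by move=> ny; apply/negP=> /invertibleD; apply/negP; rewrite negb_or nx.
by rewrite invertibleM (negPf nx) andbF.
Qed.

(** Take [z] nonzero with the smallest principal ideal. If [z * x] were nonzero for a nonunit [x],
    minimality would give [z = z * x * a], hence [z * (1 - x * a) = 0]; by locality [1 - x * a] is a
    unit, so [z = 0]. *)
Lemma socle_element :
  exists2 z : R, z != 0 & forall x, ~~ invertible x -> z * x = 0.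
Proof.
have [z z_neq0 minz] :=
  @arg_minnP R 1 (fun z => z != 0) (fun z => #|principal z|) (oner_neq0 R).
exists z => // x nx; apply/eqP; apply: contraT => zx_neq0.
have szx : principal (z * x) \subset principal z.
  by apply/subsetP=> _ /imsetP[a _ ->]; rewrite -mulrA imset_f.
have /imsetP[a _ zxa] : z \in principal (z * x).
  have /eqP-> : principal (z * x) == principal z by rewrite eqEcard szx minz.
  exact: principal_id.
have /orP[|/existsP[b /eqP xab]] : invertible (x * a) || invertible (1 - x * a).
- by apply: invertibleD; rewrite addrC subrK invertible1.
- by rewrite invertibleM (negPf nx).
case/eqP: z_neq0; rewrite -[z]mulr1 -xab mulrA mulrBr mulr1 mulrA -zxa.
by rewrite subrr mul0r.
Qed.

(** If [S] has no unit, its ideal lies in the ideal of nonunits, which the socle element kills; a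
    unit in [S] leaves only 0 in the annihilator. *)
Lemma Ann_gen_ideal_eq0 S :
  (Ann (gen_ideal S) == [set 0]) = [exists x in S, invertible x].
Proof.
apply/eqP/exists_inP=> [AnnS|[u Su /existsP[v /eqP uv]]].
  apply/exists_inP; apply: contraT; rewrite negb_exists_in => /forall_inP nS.
  have [z z_neq0 zP] := socle_element; case/negP: z_neq0.
  rewrite -in_set1 -AnnS inE.
  apply/forall_inP=> y gy; apply/eqP/zP.
  suff /subsetP/(_ y gy) : gen_ideal S \subset [set x : R | ~~ invertible x].
    by rewrite inE.
  apply: gen_ideal_sub nonunits_ideal _.
  by apply/subsetP=> x Sx; rewrite inE nS.
apply/setP=> x; rewrite !inE; apply/forall_inP/eqP=> [/(_ u)|->].
  move/(_ (mem_gen_ideal Su))/eqP => xu.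
  by rewrite -[x]mulr1 -uv mulrA xu mul0r.
by move=> y _; rewrite mul0r.
Qed.

Lemma residue_field :
  exists (K : fieldType) (f : {rmorphism R -> K}),
    forall x, (f x != 0) = invertible x.
Proof.
pose N : pred R := fun x => ~~ invertible x.
have NP : idealr_closed N.
  have /idealP[N0 ND NM] := nonunits_ideal; split=> [||a x y Nx Ny].
  - by rewrite unfold_in invertible0.
  - by rewrite unfold_in invertible1.
  move: (ND (a * x) y); rewrite !inE; apply=> //.
  by have := NM a x; rewrite !inE; apply.
pose I : idealr R := HB.pack N (isIdealr.Build R N NP).
pose Q : comNzRingType := {ideal_quot I}.
pose p : {rmorphism R -> Q} := \pi_({ideal_quot I})%qT.
have pP x : (p x != 0) = invertible x.
  have := Quotient.idealrBE I x 0; rewrite subr0 => xE.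
  rewrite -(rmorph0 p) -xE.
  by rewrite negbK.
(* The inverse is the class of some [y] found by search in [R]; the default 0 is what makes
   [inv 0 = 0]. *)
pose inv (q : Q) : Q := if [pick y | p y * q == 1] is Some y then p y else 0.
have inv0 : inv 0 = 0.
  by rewrite /inv; case: pickP => // y; rewrite mulr0 eq_sym oner_eq0.
have mulVq q : q != 0 -> inv q * q = 1.
  have -> : q = p (repr q) by rewrite /= reprK.
  rewrite pP => /existsP[y /eqP xy].
  rewrite /inv; case: pickP => [z /eqP //|/(_ y)].
  by rewrite -rmorphM mulrC xy rmorph1 eqxx.
pose K : fieldType := HB.pack Q (GRing.ComNzRing_isField.Build Q mulVq inv0).
by exists K, p.
Qed.
End Ideals.

(** * Ranks of leading windows over a field *)

Section FieldRank.
Variable K : fieldType.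
Implicit Types m n : nat.

Lemma mxrank_mxsub m n p q (f : 'I_p -> 'I_m) (g : 'I_q -> 'I_n)
    (B : 'M[K]_(m, n)) : (\rank (mxsub f g B) <= \rank B)%N.
Proof.
rewrite mxsubrc rowsubE (leq_trans (mxrankM_maxr _ _)) //.
rewrite -mxrank_tr trmx_mxsub rowsubE.
by rewrite (leq_trans (mxrankM_maxr _ _)) ?mxrank_tr.
Qed.

Lemma mxrank_support m n (B : 'M[K]_(m, n)) :
  (\rank B <= #|[set ij | B ij.1 ij.2 != 0%R]|)%N.
Proof.
rewrite {1}[B]matrix_sum_delta pair_big /=.
rewrite (bigID (fun ij => B ij.1 ij.2 != 0)) /=.
rewrite [X in _ + X]big1 ?addr0; last first.
  by move=> ij; rewrite negbK => /eqP->; rewrite scale0r.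
rewrite -sum1_card; under [X in (_ <= X)%N]eq_bigl => ij do rewrite inE.
elim/big_ind2: _ => [|u a v b ua vb|ij _]; first by rewrite mxrank0.
  exact: leq_trans (mxrank_add _ _) (leq_add ua vb).
by rewrite (leq_trans (mxrank_scale _ _)) ?mxrank_delta.
Qed.

Lemma mxrank_partial_perm m n (S : {set 'I_m * 'I_n}) :
  {in S &, injective fst} -> {in S &, injective snd} ->
  \rank (\matrix_(i, j) ((i, j) \in S)%:R : 'M[K]_(m, n)) = #|S|.
Proof.
move=> inj1 inj2; set B := (X in \rank X); apply/eqP; rewrite eqn_leq.
apply/andP; split.
  apply: leq_trans (mxrank_support B) (subset_leq_card _).
  apply/subsetP=> -[i j]; rewrite inE mxE.
  by case: (_ \in S) => //; rewrite eqxx.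
pose e (a : 'I_#|S|) := enum_val a.
rewrite -{1}(mxrank1 K #|S|).
(* Rows and columns listed along [S] cut out an identity matrix of size [#|S|], which bounds the
   rank from below. *)
suff -> : 1%:M = mxsub (fst \o e) (snd \o e) B by apply: mxrank_mxsub.
apply/matrixP=> a b; rewrite !mxE /=; congr (nat_of_bool _)%:R.
apply/idP/idP => [/eqP->|Sab]; first by rewrite -surjective_pairing enum_valP.
apply/eqP; apply: enum_val_inj; rewrite -/(e a) -/(e b).
have Sa : e a \in S := enum_valP a.
have Sb : e b \in S := enum_valP b.
by rewrite -[LHS](inj1 _ _ Sab Sa erefl) (inj2 _ _ Sab Sb erefl).
Qed.

(** The leading block is padded with zeros to the full size, so that windows can be added and
    compared as products with [pid_mx]. *)
Definition window m n i j (B : 'M[K]_(m, n)) : 'M_(m, n) :=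
  pid_mx i *m B *m pid_mx j.

Lemma windowE m n i j (B : 'M[K]_(m, n)) a b :
  window i j B a b = if (a < i)%N && (b < j)%N then B a b else 0.
Proof.
rewrite mxE (bigD1 b) //= big1 ?addr0; last first.
  by move=> k; rewrite -val_eqE => /negPf kb; rewrite !mxE /= kb mulr0.
rewrite mxE (bigD1 a) //= big1 ?addr0; last first.
  by move=> k; rewrite -val_eqE eq_sym => /negPf ka; rewrite !mxE /= ka mul0r.
rewrite !mxE !eqxx.
by do 2!case: ltnP => _; rewrite ?mulr1 ?mul1r ?mulr0 ?mul0r.
Qed.

Lemma mxrank_leading m n i j (le_im : (i <= m)%N) (le_jn : (j <= n)%N)
    (B : 'M[K]_(m, n)) :
  \rank (mxsub (widen_ord le_im) (widen_ord le_jn) B) = \rank (window i j B).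
Proof.
set L := mxsub _ _ _; apply/eqP; rewrite eqn_leq; apply/andP; split.
  have -> : L = mxsub (widen_ord le_im) (widen_ord le_jn) (window i j B).
    by apply/matrixP=> a b; rewrite [RHS]mxE windowE /= !ltn_ord mxE.
  exact: mxrank_mxsub.
(* Padding is multiplication by rectangular [pid_mx] factors, which cannot raise the rank. *)
have -> : window i j B = (pid_mx i : 'M_(m, i)) *m L *m (pid_mx j : 'M_(j, n)).
  apply/matrixP=> a b; rewrite windowE mxE.
  under eq_bigr => k _ do rewrite mxE big_distrl /=.
  rewrite pair_big /=; case: ifP => [/andP[ai bj]|ab].
    rewrite (bigD1 (Ordinal bj, Ordinal ai)) //= big1 ?addr0 => [|[l k]].
      rewrite !mxE /= !eqxx ai bj mul1r mulr1; congr (B _ _); exact: val_inj.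
    rewrite !mxE xpair_eqE -!val_eqE /= negb_and => /orP[lb|ka].
      by rewrite (negPf lb) mulr0.
    by rewrite [_ == val k]eq_sym (negPf ka) !mul0r.
  rewrite big1 // => -[l k] _; rewrite !mxE /=.
  have [al|] := eqVneq (a : nat) k; last by rewrite !mul0r.
  have [lb|] := eqVneq (l : nat) b; last by rewrite mulr0.
  by rewrite al -lb !ltn_ord in ab.
by apply: leq_trans (mxrankM_maxl _ _) (mxrankM_maxr _ _).
Qed.

Section LeadingRank.
Variables (m n : nat) (B : 'M[K]_(m, n)).
Let r i j := \rank (window i j B).

Lemma mxrank_window0l j : r 0 j = 0%N.
Proof.
apply/eqP; rewrite mxrank_eq0; apply/eqP/matrixP=> a b.
by rewrite windowE mxE.
Qed.

Lemma mxrank_window0r i : r i 0 = 0%N.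
Proof.
apply/eqP; rewrite mxrank_eq0; apply/eqP/matrixP=> a b.
by rewrite windowE mxE andbF.
Qed.

Lemma window_trans k l i j : (k <= i)%N -> (l <= j)%N ->
  window k l (window i j B) = window k l B.
Proof.
move=> ki lj; apply/matrixP=> a b; rewrite !windowE.
by case: ifP => // /andP[ak bl]; rewrite (leq_trans ak) ?(leq_trans bl).
Qed.

(** Frobenius' inequality for the product of [pid_mx k], [window i j B] and [pid_mx l]. *)
Lemma mxrank_window_supermod k l i j : (k <= i)%N -> (l <= j)%N ->
  (r k j + r i l <= r i j + r k l)%N.
Proof.
move=> ki lj; rewrite /r -(window_trans ki lj) -(window_trans ki (leqnn j)).
rewrite -(window_trans (leqnn i) lj).
rewrite [window k j _]/window [window i l _]/window.
(* The columns from [j] on already vanish, so the right factor is absorbed; the next identity does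
   the same for rows. *)
have -> : (pid_mx k : 'M_m) *m window i j B *m (pid_mx j : 'M_n) =
          pid_mx k *m window i j B.
  by rewrite /window -!mulmxA mul_pid_mx minnn pid_mx_minh.
have -> : (pid_mx i : 'M_m) *m window i j B *m (pid_mx l : 'M_n) =
          window i j B *m pid_mx l.
  by rewrite /window !mulmxA mul_pid_mx minnn pid_mx_minv.
exact: mxrank_Frobenius.
Qed.

Lemma mxrank_windowSl (i : 'I_m) j : (r i j <= r i.+1 j <= (r i j).+1)%N.
Proof.
apply/andP; split.
  rewrite /r -(window_trans (leqnSn i) (leqnn j)) /window.
  by apply: leq_trans (mxrankM_maxl _ _) (mxrankM_maxr _ _).
have -> : (r i j).+1 = (r i j + \rank (delta_mx i i : 'M[K]_m))%N.
  by rewrite mxrank_delta addn1.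
(* Adding row [i] to the window adds a matrix with left factor [delta_mx i i], of rank one. *)
have -> : r i.+1 j = \rank (window i j B + delta_mx i i *m (B *m pid_mx j))%R.
  rewrite mulmxA /window -!mulmxDl /r /window; congr (\rank (_ *m _ *m _)).
  apply/matrixP=> a b; rewrite !mxE -!val_eqE /= -natrD.
  rewrite ltnS leq_eqVlt; have [->|ab] /= := eqVneq (a : nat) b.
    by case: ltngtP.
  have [ai|//] := eqVneq (a : nat) i; have [bi|//] := eqVneq (b : nat) i.
  by rewrite ai bi eqxx in ab.
by rewrite /r (leq_trans (mxrank_add _ _)) // leq_add2l mxrankM_maxl.
Qed.

End LeadingRank.

Lemma mxrank_window_tr m n i j (B : 'M[K]_(m, n)) :
  \rank (window j i B^T) = \rank (window i j B).
Proof.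
rewrite -mxrank_tr; congr (\rank _); apply/matrixP=> a b.
by rewrite mxE !windowE mxE andbC.
Qed.

Lemma mxrank_windowSr m n (B : 'M[K]_(m, n)) i (j : 'I_n) :
  (\rank (window i j B) <= \rank (window i j.+1 B)
                        <= (\rank (window i j B)).+1)%N.
Proof. by rewrite -!(mxrank_window_tr i) mxrank_windowSl. Qed.

Lemma window_full m n (B : 'M[K]_(m, n)) : window m n B = B.
Proof. by apply/matrixP=> a b; rewrite windowE !ltn_ord. Qed.

(** Split [B] into the window and the rest. Each has rank at most its number of nonzero entries;
    since these bounds add up to the rank of [B], both are equalities. *)
Lemma mxrank_window_support m n (B : 'M[K]_(m, n)) i j :
  \rank B = #|[set ij | B ij.1 ij.2 != 0%R]| ->
  \rank (window i j B) =
    #|[set ij : 'I_m * 'I_n | [&& ij.1 < i, ij.2 < j & B ij.1 ij.2 != 0%R]]|%N.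
Proof.
move=> rkB; set T := [set _ | _] in rkB *; set W := [set _ | _].
have le1 : (\rank (window i j B) <= #|W|)%N.
  apply: leq_trans (mxrank_support _) (subset_leq_card _).
  apply/subsetP=> -[a b]; rewrite !inE windowE /=.
  by case: ifP => [/andP[-> ->]|]; rewrite ?eqxx.
have le2 : (\rank (B - window i j B)%R <= #|T :\: W|)%N.
  apply: leq_trans (mxrank_support _) (subset_leq_card _).
  apply/subsetP=> -[a b]; rewrite !inE /=.
  have -> : (B - window i j B)%R a b = B a b - window i j B a b by rewrite !mxE.
  rewrite windowE.
  by case: ifP => [_|ab]; rewrite ?subrr ?eqxx // subr0 andbA ab => ->.
have sWT : W \subset T by apply/subsetP=> ij; rewrite !inE => /and3P[].
have := mxrank_add (window i j B) (B - window i j B); rewrite addrC subrK rkB.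
have := cardsID W T; rewrite (setIidPr sWT); lia.
Qed.

End FieldRank.

(** * Counting the cells of a set in leading windows *)

Section WindowCount.
Variables m n : nat.
Implicit Types S : {set 'I_m * 'I_n}.

Definition wcount S i j := #|[set ij in S | (ij.1 < i)%N && (ij.2 < j)%N]|.

Lemma wcount0l S j : wcount S 0 j = 0%N.
Proof. by apply: eq_card0 => ij; rewrite !inE andbF. Qed.

Lemma wcount0r S i : wcount S i 0 = 0%N.
Proof. by apply: eq_card0 => ij; rewrite !inE !andbF. Qed.

(** Inclusion-exclusion at the corner cell, checked cell by cell after writing counts as sums of
    indicators, and stated without subtraction. *)
Lemma wcountS S (i : 'I_m) (j : 'I_n) :
  (wcount S i.+1 j.+1 + wcount S i j =
   wcount S i j.+1 + wcount S i.+1 j + ((i, j) \in S))%N.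
Proof.
have sum_count a b :
    wcount S a b = (\sum_(ij in S) ((ij.1 < a)%N && (ij.2 < b)%N))%N.
  rewrite /wcount -sum1_card -big_mkcondr /=.
  by apply: eq_bigl => ij; rewrite !inE.
have -> : ((i, j) \in S : nat) = (\sum_(ij in S) (ij == (i, j)))%N.
  have [Sij|nSij] := boolP (_ \in S).
    by rewrite (bigD1 (i, j)) //= eqxx big1 // => ij /andP[_ /negPf->].
  by rewrite big1 // => ij Sij; case: eqP nSij => // <-; rewrite Sij.
rewrite !sum_count -!big_split /=; apply: eq_bigr => -[a b] _.
rewrite xpair_eqE -!val_eqE /= !ltnS.
by case: (ltngtP a i); case: (ltngtP b j).
Qed.

Lemma wcount_inj S T :
  (forall i j, (i <= m)%N -> (j <= n)%N -> wcount S i j = wcount T i j) ->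
  S = T.
Proof.
move=> eqST; apply/setP=> -[i j].
have := wcountS S i j; have := wcountS T i j.
have im := ltn_ord i; have jn := ltn_ord j.
rewrite !eqST ?(ltnW im) ?(ltnW jn) //.
by do 2!case: (_ \in _) => //; lia.
Qed.

(** Zero boundary values and the second differences determine the whole table, by double
    induction. *)
Lemma wcount_unique S (r : nat -> nat -> nat) :
  (forall j, r 0 j = 0)%N -> (forall i, r i 0 = 0)%N ->
  (forall (i : 'I_m) (j : 'I_n),
    r i.+1 j.+1 + r i j = r i j.+1 + r i.+1 j + ((i, j) \in S))%N ->
  forall i j, (i <= m)%N -> (j <= n)%N -> wcount S i j = r i j.
Proof.
move=> r0l r0r rS; elim=> [|i IHi] j im jn; first by rewrite wcount0l r0l.
elim: j jn => [|j IHj] jn; first by rewrite wcount0r r0r.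
have := wcountS S (Ordinal im) (Ordinal jn).
have := rS (Ordinal im) (Ordinal jn).
have := IHi j.+1 (ltnW im) jn; have := IHi j (ltnW im) (ltnW jn).
have := IHj (ltnW jn); rewrite /=; lia.
Qed.

End WindowCount.

(** * The partial permutation read off from the ranks of the windows *)

Lemma leading_ranks_partial_perm (K : fieldType) m n (B : 'M[K]_(m, n)) :
  exists S : {set 'I_m * 'I_n},
    [/\ {in S &, injective fst}, {in S &, injective snd}
      & forall i j, (i <= m)%N -> (j <= n)%N ->
        wcount S i j = \rank (window i j B)].
Proof.
pose r i j := \rank (window i j B).
(* The cells where the second difference of [r] is positive. *)
pose S := [set ij : 'I_m * 'I_n |
  r ij.1 ij.2.+1 + r ij.1.+1 ij.2 < r ij.1.+1 ij.2.+1 + r ij.1 ij.2]%N.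
have supermod := mxrank_window_supermod B.
have stepl := mxrank_windowSl B; have stepr := mxrank_windowSr B.
exists S; split.
(* For fixed [i], the increment [r i.+1 j - r i j] is 0 or 1 and, by supermodularity, nondecreasing
   in [j]. Each cell of [S] in row [i] makes it jump, so there is at most one; columns are
   symmetric. *)
- move=> [i j] [i' j'] + + /= ii'; rewrite -{i'}ii' !inE /= => Sj Sj'.
  congr pair; apply: val_inj => /=.
  have := stepl i j; have := stepl i j.+1;
  have := stepl i j'; have := stepl i j'.+1.
  have := supermod i j.+1 i.+1 j'; have := supermod i j'.+1 i.+1 j.
  rewrite -/(r _ _) leqnSn -!/(r _ _); case: (ltngtP j j') => // jj'; lia.
- move=> [i j] [i' j'] + + /= jj'; rewrite -{j'}jj' !inE /= => Si Si'.
  congr pair; apply: val_inj => /=.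
  have := stepr i j; have := stepr i.+1 j;
  have := stepr i' j; have := stepr i'.+1 j.
  have := supermod i.+1 j i' j.+1; have := supermod i'.+1 j i j.+1.
  rewrite leqnSn -!/(r _ _); case: (ltngtP i i') => // ii'; lia.
apply: wcount_unique => [j|i|i j]; rewrite ?mxrank_window0l ?mxrank_window0r //.
(* The second difference is nonnegative by supermodularity and at most 1 as a difference of such
   increments, so it equals membership in [S]. *)
have := stepl i j; have := stepl i j.+1;
have := stepr i j; have := stepr i.+1 j.
have := supermod i j i.+1 j.+1 (leqnSn i) (leqnSn j).
rewrite inE /= -!/(r _ _); lia.
Qed.

(** * Rank over a field through minors with increasing indices *)

Lemma enum_val_increasing m (A : {set 'I_m}) :
  strictly_increasing (finfun (@enum_val _ (mem A))).
Proof.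
apply/forallP=> a; apply/forallP=> b; apply/implyP=> ltab; rewrite !ffunE.
have x0 : 'I_m by apply: enum_val a.
rewrite !(enum_val_nth x0).
have sortedA : sorted (relpre val ltn) (enum A).
  rewrite /(enum _) -enumT; apply: sorted_filter.
    by move=> y x z; apply: ltn_trans.
  by rewrite -sorted_map val_enum_ord iota_ltn_sorted.
have transA : transitive (relpre (@nat_of_ord m) ltn).
  by move=> y x z; apply: ltn_trans.
by apply: (sorted_ltn_nth transA x0 sortedA); rewrite ?inE -?cardE.
Qed.

Section Minors.
Variable K : fieldType.

Lemma increasing_rows m n t (B : 'M[K]_(m, n)) : (t <= \rank B)%N ->
  exists2 f : {ffun 'I_t -> 'I_m},
    strictly_increasing f & \rank (rowsub f B) = t.
Proof.
move=> le_t; pose F := maxrankfun B \o widen_ord le_t.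
have injF : injective F.
  by move=> a b /maxrankfun_inj /(congr1 val) /= /val_inj.
(* The independent rows given by [F] need not come in order; only their set matters, as its
   enumeration is increasing. *)
suff [A cardA] : exists2 A : {set 'I_m},
    #|A| = t & (t <= \rank (rowsub (@enum_val _ (mem A)) B))%N.
  case: t / cardA {le_t F injF} => le_t; exists (finfun (@enum_val _ (mem A))).
    exact: enum_val_increasing.
  by apply/eqP; rewrite mxsub_ffunl eqn_leq rank_leq_row.
exists (F @: [set: 'I_t]); first by rewrite card_imset // cardsT card_ord.
have FA a : F a \in F @: [set: 'I_t] by rewrite imset_f.
have rkF : \rank (rowsub F B) = t.
  rewrite /F rowsub_comp rowsubE mxrankMfree ?maxrowsub_free // -pid_mxErow.
  exact: rank_pid_mx.
rewrite -{1}rkF; apply: mxrankS; set e := enum_val.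
rewrite (_ : rowsub F B = rowsub (e \o (fun a => enum_rank_in (FA a) (F a))) B).
  exact: rowsub_comp_sub.
by apply/matrixP=> a b; rewrite !mxE /= /e enum_rankK_in.
Qed.

(** Select [t] independent rows, then [t] independent columns among them through the transpose;
    conversely a nonzero minor gives an invertible sub-matrix. *)
Lemma mxrank_minorP m n t (B : 'M[K]_(m, n)) :
  reflect (exists (f : {ffun 'I_t -> 'I_m}) (g : {ffun 'I_t -> 'I_n}),
             [/\ strictly_increasing f, strictly_increasing g
               & \det (mxsub f g B) != 0])
          (t <= \rank B)%N.
Proof.
apply: (iffP idP) => [le_t|[f [g [_ _ detB]]]]; last first.
  have /mxrank_unit {1}<- : mxsub f g B \in unitmx by rewrite unitmxE unitfE.
  exact: mxrank_mxsub.
have [f incf rkf] := increasing_rows le_t.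
have [|g incg rkg] := @increasing_rows _ _ t (rowsub f B)^T.
  by rewrite mxrank_tr rkf.
exists f, g; split=> //; rewrite -unitfE -unitmxE -row_free_unit -row_leq_rank.
by rewrite -[X in (X <= _)%N]rkg -mxrank_tr trmx_mxsub trmxK -mxsubcr.
Qed.
End Minors.

(** * McCoy's rank as a rank over the residue field, and the theorem *)

Section McCoy.
Variables (R : finComNzRingType) (K : fieldType) (f : {rmorphism R -> K}).
Hypothesis chainR : chain_ring R.
Hypothesis fP : forall x, (f x != 0) = invertible x.

(** A minor of [A] is a unit exactly when its image under [f] is nonzero, so the admissible [t] are
    those up to the rank of the image. *)
Lemma mccoy_rankE m n (A : 'M[R]_(m, n)) : mccoy_rank A = \rank (map_mx f A).
Proof.
have AnnE t : (Ann (minor_ideal t A) == [set 0]) = (t <= \rank (map_mx f A))%N.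
  rewrite /minor_ideal Ann_gen_ideal_eq0 //.
  apply/exists_inP/mxrank_minorP => [[_ /imset2P[g h incg inch ->]]|].
    by rewrite -fP -det_map_mx map_mxsub; exists g, h.
  move=> [g [h [incg inch detA]]]; exists (\det (mxsub g h A)).
    exact: imset2_f.
  by rewrite -fP -det_map_mx map_mxsub.
rewrite /mccoy_rank.
rewrite (eq_bigl (fun t : 'I_(_).+1 => t <= \rank (map_mx f A))%N) => [|t];
  last exact: AnnE.
apply/eqP; rewrite eqn_leq; apply/andP; split; first exact/bigmax_leqP.
have ltr : (\rank (map_mx f A) < (minn m n).+1)%N.
  by rewrite ltnS leq_min rank_leq_row rank_leq_col.
exact: (@leq_bigmax_cond _ _ _ (Ordinal ltr)).
Qed.

End McCoy.

Theorem corollary11 (R : finComNzRingType) (chainR : chain_ring R)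
    (m n r : nat) (A : 'M[R]_(m, n)) (rankA : mccoy_rank A = r) :
  exists! P : 'M[R]_(m, n),
    sub_permutation r P /\
    (forall (i j : nat) (le_im : (i <= m)%N) (le_jn : (j <= n)%N),
       (1 <= i)%N -> (1 <= j)%N ->
       mccoy_rank (leading le_im le_jn P) =
       mccoy_rank (leading le_im le_jn A)).
Proof.
have [K [f fP]] := residue_field chainR.
have rankE k l (B : 'M[R]_(k, l)) := mccoy_rankE chainR fP B.
have leadE i j (le_im : (i <= m)%N) (le_jn : (j <= n)%N) (B : 'M[R]_(m, n)) :
    mccoy_rank (leading le_im le_jn B) = \rank (window i j (map_mx f B)).
  by rewrite rankE map_mxsub mxrank_leading.
pose supp (P : 'M[R]_(m, n)) := [set ij : 'I_m * 'I_n | P ij.1 ij.2 != 0].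
have suppE P : sub_permutation r P -> P = \matrix_(i, j) ((i, j) \in supp P)%:R.
  case=> _ _ P01; apply/matrixP=> i j; rewrite mxE inE /=.
  by case: eqVneq => [->|/P01].
have rankP P i j : sub_permutation r P ->
    \rank (window i j (map_mx f P)) = wcount (supp P) i j.
  (* The entries are 0 or 1, so [f] preserves the support and the support bound on the rank is
     attained. *)
  case=> rkP cardP P01; have fP0 a b : (map_mx f P a b != 0) = (P a b != 0).
    rewrite mxE; have [->|/P01->] := eqVneq (P a b) 0.
      by rewrite rmorph0 eqxx.
    by rewrite rmorph1 oner_eq0.
  rewrite mxrank_window_support; last first.
    by rewrite -rankE rkP -cardP; apply: eq_card => ij; rewrite !inE fP0.
  by apply: eq_card => ij; rewrite !inE fP0 [RHS]andbC andbA.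
have [S [inj1 inj2 countS]] := leading_ranks_partial_perm (map_mx f A).
pose P : 'M[R]_(m, n) := \matrix_(i, j) ((i, j) \in S)%:R.
have suppP : supp P = S.
  apply/setP=> -[i j]; rewrite inE mxE.
  by case: (_ \in S); rewrite ?oner_eq0 ?eqxx.
have fPE : map_mx f P = \matrix_(i, j) ((i, j) \in S)%:R.
  by apply/matrixP=> i j; rewrite !mxE rmorph_nat.
(* The full window contains all of [S]. *)
have cardS : #|S| = r.
  rewrite -rankA rankE -[map_mx f A]window_full -countS //.
  by apply: eq_card => ij; rewrite !inE !ltn_ord /= andbT.
have subP : sub_permutation r P.
  split; first by rewrite rankE fPE mxrank_partial_perm.
    by rewrite -/(supp P) suppP.
  by move=> i j; rewrite mxE; case: (_ \in S); rewrite ?eqxx.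
exists P; split; first split=> // [i j le_im le_jn _ _].
  by rewrite !leadE rankP // suppP countS.
move=> Q [subQ leadQ]; rewrite [RHS](suppE Q subQ) /P; congr matrix_of_fun.
suff -> : S = supp Q by [].
apply: wcount_inj => i j le_im le_jn.
(* Empty windows are not covered by the hypothesis on [Q]; there both counts are 0. *)
have [->|i_gt0] := posnP i; first by rewrite !wcount0l.
have [->|j_gt0] := posnP j; first by rewrite !wcount0r.
by rewrite countS // -!leadE -leadQ // leadE rankP.
Qed.
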